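(* Let $G=(V,E)$ be an undirected $d$-regular graph of diameter $2$ with $n=\alpha\cdot d^2$ vertices. Then $$\phi_V(G)\ge\frac{2\alpha}{2\alpha+1}.$$
   Context: Graphs are finite and simple; the diameter is the maximum distance between two vertices. The vertex expansion is $\phi_V(G):=\min_{0<|S|\le n/2}\frac{|N(S)|}{|S|}$, where $S$ ranges over subsets of $V$ and $N(S):=\{v\in V\setminus S:\exists u\in S\text{ with }(u,v)\in E\}$. *)

(* Defs.v *)
From HB Require Import structures.
From mathcomp Require Import all_boot all_order all_algebra.

Set Implicit Arguments.
Unset Strict Implicit.
Unset Printing Implicit Defensive.

Import Order.TTheory GRing.Theory Num.Theory.

Local Open Scope ring_scope.

Definition simple_graph (T : finType) (e : rel T) : Prop :=
  symmetric e /\ irreflexive e.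

Definition regular (T : finType) (e : rel T) (d : nat) : Prop :=
  forall x : T, #|[set y | e x y]| = d.

Definition walk_of_length (T : finType) (e : rel T) (x y : T) (k : nat) : bool :=
  [exists p : k.-tuple T, path e x p && (last x p == y)].

(* The least length of a walk from x to y. In a graph on #|T| vertices it is
   less than #|T| when y is reachable from x; otherwise the search returns the
   junk value #|T|, which is never used in diameter below. *)
Definition distance (T : finType) (e : rel T) (x y : T) : nat :=
  find (walk_of_length e x y) (iota 0 #|T|).

(* None stands for the infinite diameter of a disconnected graph. *)
Definition diameter (T : finType) (e : rel T) : option nat :=
  if [forall x, forall y, connect e x y]
  then Some (\max_(x : T) \max_(y : T) distance e x y)%N
  else None.

Definition out_neighbours (T : finType) (e : rel T) (S : {set T}) : {set T} :=
  [set v in ~: S | [exists u in S, e u v]].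

Definition expansion_ratio (R : realFieldType) (T : finType) (e : rel T)
    (S : {set T}) : R :=
  #|out_neighbours e S|%:R / #|S|%:R.

Definition admissible (T : finType) (S : {set T}) : bool :=
  (0 < #|S|)%N && (2 * #|S| <= #|T|)%N.

(* The neutral element #|T| bounds every ratio from above, so it does not
   affect the minimum as soon as some S is admissible, i.e. when #|T| >= 2:
   see vertex_expansion_le and vertex_expansion_attained. *)
Definition vertex_expansion (R : realFieldType) (T : finType) (e : rel T) : R :=
  \big[Num.min/#|T|%:R]_(S : {set T} | admissible S) expansion_ratio R e S.

Lemma expansion_ratio_le_card (R : realFieldType) (T : finType) (e : rel T)
    (S : {set T}) :
  admissible S -> expansion_ratio R e S <= #|T|%:R.
Proof.
case/andP=> S_gt0 _; rewrite /expansion_ratio ler_pdivrMr ?ltr0n //.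
by rewrite -natrM ler_nat (leq_trans (max_card _)) // leq_pmulr.
Qed.

Lemma vertex_expansion_le (R : realFieldType) (T : finType) (e : rel T)
    (S : {set T}) :
  admissible S -> vertex_expansion R e <= expansion_ratio R e S.
Proof. by move=> adS; rewrite /vertex_expansion (bigD1 S) //= ge_min lexx. Qed.

Lemma vertex_expansion_attained (R : realFieldType) (T : finType) (e : rel T) :
  (1 < #|T|)%N ->
  exists2 S : {set T}, admissible S & vertex_expansion R e = expansion_ratio R e S.
Proof.
move=> T_gt1.
have [x _] : exists x : T, x \in T by apply/card_gt0P; apply: ltnW.
have ad1 : admissible [set x] by rewrite /admissible cards1.
have [|eqT] : (exists2 S : {set T}, admissible S &
    vertex_expansion R e = expansion_ratio R e S) \/
    vertex_expansion R e = #|T|%:R => //.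
  rewrite /vertex_expansion; apply: (big_ind (fun m : R =>
    (exists2 S : {set T}, admissible S & m = expansion_ratio R e S) \/
    m = #|T|%:R)); first by right.
  - by move=> a b Ka Kb; rewrite /Num.min; case: ifP.
  - by move=> S adS; left; exists S.
exists [set x] => //; apply/le_anti; rewrite vertex_expansion_le //= eqT.
exact: expansion_ratio_le_card.
Qed.

(* Main.v *)
Require Import Defs.
From HB Require Import structures.
From mathcomp Require Import all_boot all_order all_algebra.
From mathcomp Require Import zify lra.

(** Fix [S] with [0 < 2|S| <= n] and let [C] be the set of vertices outside
    [S] and [N(S)]. Since the diameter is 2, every pair in [S * C] is joined by
    a path of length 2, whose middle vertex [w] must lie in [N(S)]. If [w] has
    [a] neighbours in [S], it is the middle of at most [a (d - a) <= d^2 / 4]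
    such paths, so [4 |S| |C| <= |N(S)| d^2]. Substituting
    [|C| = n - |S| - |N(S)|] and [2|S| <= n] gives
    [2 n |S| <= |N(S)| (2 n + d^2)]. *)

Set Implicit Arguments.
Unset Strict Implicit.
Unset Printing Implicit Defensive.

Import Order.TTheory GRing.Theory Num.Theory.

Local Open Scope ring_scope.

(** A shortened path repeats no vertex, so it has fewer than [#|T|] edges; the search over
    [iota 0 #|T|] therefore succeeds and does not return its junk value. *)
Lemma walk_of_distance (T : finType) (e : rel T) (x y : T) :
  connect e x y -> walk_of_length e x y (distance e x y).
Proof.
case/connectP=> p0 /shortenP[p e_p uniq_p _] y_last.
have p_lt : (size p < #|T|)%N.
  by have := max_card (mem (x :: p)); rewrite (card_uniqP uniq_p).
have has_walk : has (walk_of_length e x y) (iota 0 #|T|).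
  apply/hasP; exists (size p); first by rewrite mem_iota.
  by apply/existsP; exists (in_tuple p); rewrite /= e_p -y_last eqxx.
have := nth_find 0%N has_walk; rewrite nth_iota //.
by rewrite has_find size_iota in has_walk.
Qed.

Lemma diameter2_cases (T : finType) (e : rel T) (x y : T) :
  diameter e = Some 2%N ->
  [\/ x = y, e x y | exists2 w, e x w & e w y].
Proof.
rewrite /diameter; case: ifP => // /forallP conn [diam].
have le2 : (distance e x y <= 2)%N.
  rewrite -diam; apply: (@leq_trans (\max_(z : T) distance e x z)).
    exact: leq_bigmax.
  exact: (@leq_bigmax _ (fun x => \max_(z : T) distance e x z)%N).
have := walk_of_distance (forallP (conn x) y).
case: (distance e x y) le2 => [|[|[|//]]] _ /existsP[[[|a [|b [|]]] //= _]].
- by move/eqP; constructor 1.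
- by case/andP=> /andP[exa _] /eqP <-; constructor 2.
- by case/andP=> /and3P[exa eab _] /eqP <-; constructor 3; exists a.
Qed.

Lemma leq_card_bigcup (I T : finType) (P : pred I) (F : I -> {set T}) :
  (#|\bigcup_(i | P i) F i| <= \sum_(i | P i) #|F i|)%N.
Proof.
elim/big_ind2: _ => [|m A n B leA leB|//]; first by rewrite cards0.
by rewrite (leq_trans (leq_card_setU A B)) ?leq_add.
Qed.

Lemma diameter2_separated_pairs (T : finType) (e : rel T) (d : nat)
    (S : {set T}) :
  symmetric e -> regular e d -> diameter e = Some 2%N ->
  (4 * (#|S| * #|~: (S :|: out_neighbours e S)|)
     <= #|out_neighbours e S| * d ^ 2)%N.
Proof.
move=> sym_e reg_e diam; set N := out_neighbours e S; set C := ~: _.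
pose nb w := [set y | e w y].
(* Pairs are sorted by the middle vertex [w] of a path of length 2: [u] is a neighbour of [w] inside
   [S], and [v] one outside. *)
have sub : setX S C \subset
    \bigcup_(w in N) setX (nb w :&: S) (nb w :\: S).
  apply/subsetP=> -[u v]; rewrite !inE /= negb_or negb_and negbK => /andP[uS].
  case/andP=> vS /orP[|noSv]; first by rewrite (negPf vS).
  have notS u' : u' \in S -> ~~ e u' v.
    by move=> u'S; apply: contra noSv => eu'v; apply/existsP; exists u'; apply/andP.
  case: (diameter2_cases u v diam) => [uv|euv|[w euw ewv]].
  - by rewrite uv (negPf vS) in uS.
  - by move: (notS u uS); rewrite euv.
  (* A middle vertex in [S] would put [v] in [N]. *)
  have wS : w \notin S by apply: contraL ewv; apply: notS.
  apply/bigcupP; exists w; last by rewrite !inE /= sym_e euw ewv uS vS.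
  by rewrite !inE wS; apply/existsP; exists u; rewrite uS.
rewrite -cardsX.
apply: (@leq_trans (4 * \sum_(w in N) #|setX (nb w :&: S) (nb w :\: S)|)%N).
  by rewrite leq_mul2l (leq_trans (subset_leq_card sub)) ?leq_card_bigcup.
rewrite big_distrr /= -sum_nat_const; apply: leq_sum => w _.
(* The two factors split the [d] neighbours of [w], so AM-GM bounds four times their product by
   [d ^ 2]. *)
by rewrite cardsX -(reg_e w) -(cardsID S (nb w)) nat_AGM2.
Qed.

Lemma diameter2_expansion_nat (T : finType) (e : rel T) (d : nat)
    (S : {set T}) :
  symmetric e -> regular e d -> diameter e = Some 2%N -> (2 * #|S| <= #|T|)%N ->
  (2 * #|T| * #|S| <= #|out_neighbours e S| * (2 * #|T| + d ^ 2))%N.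
Proof.
move=> sym_e reg_e diam S_half.
have := diameter2_separated_pairs S sym_e reg_e diam.
have := cardsC (S :|: out_neighbours e S).
have -> : #|S :|: out_neighbours e S| = (#|S| + #|out_neighbours e S|)%N.
  rewrite cardsU (_ : S :&: _ = set0) ?cards0 ?subn0 //.
  by apply/setP=> v; rewrite !inE; case: (v \in S).
(* With [c = n - s - N], it remains to use [n <= 2 * (n - s)] and [4 * s <= 2 * n]. *)
by move: #|~: _| #|out_neighbours e S| #|S| #|T| S_half => c N s n; nia.
Qed.

Theorem theorem4p6 (R : realFieldType) (T : finType) (e : rel T)
    (d : nat) (alpha : R) :
  simple_graph e ->
  regular e d ->
  diameter e = Some 2%N ->
  #|T|%:R = alpha * d%:R ^+ 2 ->
  vertex_expansion R e >= 2 * alpha / (2 * alpha + 1).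
Proof.
move=> [sym_e _] reg_e diam cardT.
(* On an empty type the maxima are empty and the diameter would be 0. *)
have T_gt0 : (0 < #|T|)%N.
  move: diam; rewrite /diameter; case: ifP => // _ [diam].
  rewrite lt0n; apply/eqP=> T0; move: diam.
  by rewrite big1 // => x; have := fintype0 x T0.
have n_gt0 : 0 < #|T|%:R :> R by rewrite ltr0n.
have d2_gt0 : 0 < d%:R ^+ 2 :> R.
  rewrite lt_def sqr_ge0 andbT; apply/eqP=> d0.
  by move: n_gt0; rewrite cardT d0 mulr0 ltxx.
have alpha_gt0 : 0 < alpha by rewrite -(pmulr_lgt0 _ d2_gt0) -cardT.
have den_gt0 : 0 < 2 * alpha + 1 by lra.
rewrite /vertex_expansion; elim/big_ind: _ => [|a b ha hb|S /andP[S_gt0 S_half]].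
(* The neutral element [#|T|] is at least 1, and the claimed bound is below 1. *)
- have : 1 <= #|T|%:R :> R by rewrite ler1n.
  by apply: le_trans; rewrite ler_pdivrMr //; lra.
- by rewrite le_min ha hb.
have := diameter2_expansion_nat sym_e reg_e diam S_half.
rewrite -(ler_nat R) !natrM natrD natrM natrX cardT => bound.
rewrite /expansion_ratio ler_pdivrMr // mulrAC ler_pdivlMr ?ltr0n //.
(* Multiplying by [d ^ 2] restores the factor common to both sides of [bound]. *)
by rewrite -(ler_pM2r d2_gt0); lra.
Qed.
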